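(* For $k\in\mathbb{C}$ and $c\in[0,1]$ let $F_{\mathrm{even}}(k,c)=i\cos(kc\pi)+i\cos(k\pi)+2\sin(k\pi)$. (i) For any $c\in[0,1]$, any $n\in\mathbb{Z}$ and any real $y\ge0$ one has $F_{\mathrm{even}}(n+\tfrac12-iy,c)\neq0$. (ii) For any $c\in[0,1)$ and any $k=x-iy$ with $x,y\in\mathbb{R}$ and $y>\frac{\log 3}{\pi(1-|c|)}$ one has $F_{\mathrm{even}}(k,c)\neq0$.
   Context: The zeros of $F_{\mathrm{even}}(\cdot,c)$ are called the even resonances of the quantum graph $\mathcal{G}(c)$, which for $c<1$ is a circle of length $2\pi$ made of two edges of lengths $(1-c)\pi$ and $(1+c)\pi$ joining two vertices, with one infinite lead attached at each vertex, and for $c=1$ is a circle of length $2\pi$ with two leads attached at the same point. The claim itself concerns only the explicit function $F_{\mathrm{even}}$. *)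

(* Defs.v *)
From Stdlib Require Import Reals ZArith Lra.
From Coquelicot Require Import Coquelicot.

Local Open Scope C_scope.

(* Coquelicot has no transcendental functions on C: exp(a + ib) = e^a (cos b + i sin b),
   and cos, sin are given by Euler's formulas. *)
Definition Cexp (z : C) : C :=
  RtoC (exp (Re z)) * (cos (Im z), sin (Im z)).

Definition Ccos (z : C) : C := (Cexp (Ci * z) + Cexp (- (Ci * z))) / 2.

Definition Csin (z : C) : C := (Cexp (Ci * z) - Cexp (- (Ci * z))) / (2 * Ci).

Definition F_even (k : C) (c : R) : C :=
  Ci * Ccos (k * c * PI) + Ci * Ccos (k * PI) + 2 * Csin (k * PI).

Lemma Ccos_RtoC (x : R) : Ccos (RtoC x) = RtoC (cos x).
Proof.
unfold Ccos, Cexp, RtoC, Ci, Cdiv, Cinv, Cmult, Cplus, Copp, Re, Im; simpl.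
apply injective_projections; simpl;
  replace (0 * x - 1 * 0)%R with 0%R by ring;
  replace (0 * 0 + 1 * x)%R with x by ring;
  rewrite ?Ropp_0, exp_0, cos_neg, sin_neg; field.
Qed.

Lemma Csin_RtoC (x : R) : Csin (RtoC x) = RtoC (sin x).
Proof.
unfold Csin, Cexp, RtoC, Ci, Cdiv, Cinv, Cmult, Cminus, Cplus, Copp, Re, Im; simpl.
apply injective_projections; simpl;
  replace (0 * x - 1 * 0)%R with 0%R by ring;
  replace (0 * 0 + 1 * x)%R with x by ring;
  rewrite ?Ropp_0, exp_0, cos_neg, sin_neg; field.
Qed.

(* Main.v *)
Require Import Defs.
From Stdlib Require Import Reals ZArith Lra.
From Coquelicot Require Import Coquelicot.

(** Write [k = x - i y], [a = x PI] and [b = y PI].  Splitting sine and cosine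
    into real and imaginary parts gives
      [Re F = sin a (2 cosh b - sinh b) - sin (c a) sinh (c b)],
      [Im F = cos (c a) cosh (c b) - cos a (2 sinh b - cosh b)]
    (lemma [F_even_parts]).

    On the half-integer lines [cos a = 0], so [sin a] is a sign and the real part
    alone decides: its first term has absolute value [2 cosh b - sinh b > sinh b],
    its second at most [sinh (c b) <= sinh b], so they cannot cancel.

    In the second part [exp b > 3 exp (c b)].  If both parts vanished, the two
    products with [sin a] and [cos a] would be the two products with [sin (c a)]
    and [cos (c a)].  The coefficients [2 cosh b - sinh b = (exp b + 3 exp (- b)) / 2]
    and [2 sinh b - cosh b = (exp b - 3 exp (- b)) / 2] both exceed [cosh (c b)]
    (lemma [cosh_lt_2sinh_sub_cosh]), so the point they make with [(sin a, cos a)] lies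
    outside the disc of radius [cosh (c b)], while the other point lies inside it
    (lemma [ellipse_points_distinct]). *)

Local Open Scope R_scope.

Lemma Ccos_parts (a b : R) :
  Ccos (a, b) = (cos a * cosh b, - (sin a * sinh b)).
Proof.
unfold Ccos, Cexp, cosh, sinh, RtoC, Ci, Cdiv, Cinv, Cmult, Cplus, Copp, Re, Im; simpl.
replace (0 * a - 1 * b) with (- b) by ring.
replace (0 * b + 1 * a) with a by ring.
rewrite Ropp_involutive, cos_neg, sin_neg.
apply injective_projections; simpl; field.
Qed.

Lemma Csin_parts (a b : R) :
  Csin (a, b) = (sin a * cosh b, cos a * sinh b).
Proof.
unfold Csin, Cexp, cosh, sinh, RtoC, Ci, Cdiv, Cinv, Cmult, Cminus, Cplus, Copp, Re, Im; simpl.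
replace (0 * a - 1 * b) with (- b) by ring.
replace (0 * b + 1 * a) with a by ring.
rewrite Ropp_involutive, cos_neg, sin_neg.
apply injective_projections; simpl; field.
Qed.

Lemma F_even_parts (c x y : R) :
  F_even (RtoC x - Ci * RtoC y)%C c =
  (sin (x * PI) * (2 * cosh (y * PI) - sinh (y * PI))
     - sin (c * (x * PI)) * sinh (c * (y * PI)),
   cos (c * (x * PI)) * cosh (c * (y * PI))
     - cos (x * PI) * (2 * sinh (y * PI) - cosh (y * PI))).
Proof.
unfold F_even.
replace ((RtoC x - Ci * RtoC y) * RtoC c * RtoC PI)%C
  with (c * (x * PI), - (c * (y * PI)))
  by (apply injective_projections; simpl; ring).
replace ((RtoC x - Ci * RtoC y) * RtoC PI)%C with (x * PI, - (y * PI))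
  by (apply injective_projections; simpl; ring).
rewrite !Ccos_parts, Csin_parts.
unfold cosh, sinh; rewrite !Ropp_involutive.
apply injective_projections; simpl; field.
Qed.

Lemma exp_le_exp (u v : R) : u <= v -> exp u <= exp v.
Proof.
intros [H | ->]; [left; now apply exp_increasing | lra].
Qed.

Lemma sinh_le_mono (u v : R) : u <= v -> sinh u <= sinh v.
Proof.
intros H; unfold sinh.
pose proof (exp_le_exp u v H).
pose proof (exp_le_exp (- v) (- u) ltac:(lra)).
lra.
Qed.

Lemma cos_half_integer (n : Z) : cos ((IZR n + 1 / 2) * PI) = 0.
Proof.
apply cos_eq_0_1; exists n; field.
Qed.

(** Doubled, the claim reads [exp t + exp (- t) + 3 * exp (- b) < exp b].  The
    hypothesis on [b - t] says both [3 * exp t < exp b] and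
    [3 * exp (- b) < exp (- t)], and [exp (- t) <= exp t], so the left side is
    less than [3 * exp t]. *)
Lemma cosh_lt_2sinh_sub_cosh (b t : R) :
  0 <= t -> ln 3 < b - t -> cosh t < 2 * sinh b - cosh b.
Proof.
intros Ht Hbt.
assert (Hlarge : 3 * exp t < exp b).
{ replace (exp b) with (exp (b - t) * exp t)
    by (rewrite <- exp_plus; f_equal; ring).
  apply Rmult_lt_compat_r; [apply exp_pos |].
  rewrite <- (exp_ln 3) by lra.
  now apply exp_increasing. }
assert (Hsmall : 3 * exp (- b) < exp (- t)).
{ replace (exp (- t)) with (exp (b - t) * exp (- b))
    by (rewrite <- exp_plus; f_equal; ring).
  apply Rmult_lt_compat_r; [apply exp_pos |].
  rewrite <- (exp_ln 3) by lra.
  now apply exp_increasing. }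
pose proof (exp_le_exp 0 t Ht) as H1.
pose proof (exp_le_exp (- t) 0 ltac:(lra)) as H2.
rewrite exp_0 in H1, H2.
unfold cosh, sinh; lra.
Qed.

(** Compare norms: a point of an ellipse is at least as far from the centre as
    its shorter semi-axis [q], and at most as far as its longer one. *)
Lemma ellipse_points_distinct (s t p q r u : R) :
  0 <= u <= r -> r < q <= p ->
  sin s * p = sin t * u -> cos s * q = cos t * r -> False.
Proof.
intros Hu Hq Hsin Hcos.
pose proof (sin2_cos2 s) as Hs; pose proof (sin2_cos2 t) as Ht.
unfold Rsqr in Hs, Ht.
assert (Hsin2 : (sin s * sin s) * (p * p) = (sin t * sin t) * (u * u)).
{ replace ((sin s * sin s) * (p * p)) with ((sin s * p) * (sin s * p)) by ring.
  rewrite Hsin; ring. }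
assert (Hcos2 : (cos s * cos s) * (q * q) = (cos t * cos t) * (r * r)).
{ replace ((cos s * cos s) * (q * q)) with ((cos s * q) * (cos s * q)) by ring.
  rewrite Hcos; ring. }
assert (Hpq : (sin s * sin s) * (q * q) <= (sin s * sin s) * (p * p))
  by (apply Rmult_le_compat_l; nra).
assert (Hur : (sin t * sin t) * (u * u) <= (sin t * sin t) * (r * r))
  by (apply Rmult_le_compat_l; nra).
assert (Hqq : q * q = (sin s * sin s) * (q * q) + (cos s * cos s) * (q * q))
  by (rewrite <- Rmult_plus_distr_r, Hs; ring).
assert (Hrr : r * r = (sin t * sin t) * (r * r) + (cos t * cos t) * (r * r))
  by (rewrite <- Rmult_plus_distr_r, Ht; ring).
nra.
Qed.

Theorem theorem6p4 :
  (forall (c : R) (n : Z) (y : R),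
      (0 <= c <= 1)%R -> (0 <= y)%R ->
      F_even (RtoC (IZR n + 1 / 2) - Ci * RtoC y)%C c <> RtoC 0) /\
  (forall (c x y : R),
      (0 <= c < 1)%R -> (ln 3 / (PI * (1 - Rabs c)) < y)%R ->
      F_even (RtoC x - Ci * RtoC y)%C c <> RtoC 0).
Proof.
pose proof PI_RGT_0 as HPI.
split.
- intros c n y Hc Hy HF.
  rewrite F_even_parts in HF.
  apply (f_equal fst) in HF; simpl in HF.
  pose proof (cos_half_integer n) as Hcos.
  set (a := (IZR n + 1 / 2) * PI) in *.
  set (b := y * PI) in *.
  assert (Hb : 0 <= b) by (unfold b; nra).
  assert (H0 : 0 <= sinh (c * b))
    by (rewrite <- sinh_0; apply sinh_le_mono; nra).
  assert (H1 : sinh (c * b) <= sinh b) by (apply sinh_le_mono; nra).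
  assert (H2 : sinh b < cosh b)
    by (unfold sinh, cosh; pose proof (exp_pos (- b)); lra).
  pose proof (SIN_bound (c * a)) as Hbound.
  assert (Hsign : sin a = 1 \/ sin a = -1).
  { pose proof (sin2_cos2 a) as H; unfold Rsqr in H; rewrite Hcos in H.
    assert (Hprod : (sin a - 1) * (sin a + 1) = 0) by lra.
    apply Rmult_integral in Hprod; lra. }
  destruct Hsign as [E | E]; rewrite E in HF; nra.
- intros c x y Hc Hy HF.
  rewrite Rabs_pos_eq in Hy by lra.
  rewrite F_even_parts in HF.
  pose proof (f_equal fst HF) as Hre; pose proof (f_equal snd HF) as Him.
  simpl in Hre, Him.
  set (a := x * PI) in *.
  set (b := y * PI) in *.
  assert (Hln : 0 < ln 3) by (rewrite <- ln_1; apply ln_increasing; lra).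
  assert (Hgap : ln 3 < b - c * b).
  { apply Rlt_div_l in Hy; [| nra].
    unfold b; lra. }
  assert (Hb : 0 < b) by nra.
  assert (Hcb : 0 <= c * b) by nra.
  pose proof (cosh_lt_2sinh_sub_cosh b (c * b) Hcb Hgap) as Hlt.
  assert (H0 : 0 <= sinh (c * b))
    by (rewrite <- sinh_0; now apply sinh_le_mono).
  apply (ellipse_points_distinct a (c * a)
           (2 * cosh b - sinh b) (2 * sinh b - cosh b)
           (cosh (c * b)) (sinh (c * b))); try lra.
  + split; [exact H0 |].
    unfold sinh, cosh; pose proof (exp_pos (- (c * b))); lra.
  + split; [exact Hlt |].
    unfold sinh, cosh; pose proof (exp_pos (- b)); lra.
Qed.
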